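(* Let $\lambda,b_1,v_1,\alpha\in\mathbb{R}$ with $\lambda\neq 0$ and $v_1\alpha\ne 0$, let $f\in\mathbb{R}[t]$, and put $t=\lambda(y+b_1x+v_1\alpha x^2)$. Let $H:\mathbb{R}^4\to\mathbb{R}^4$ be the polynomial map $$H(x,y,z,w)=f(t)\,\bigl(-1,\ b_1+2v_1\alpha x,\ -\alpha f(t),\ \lambda(b_1+2v_1\alpha x)\bigr)+\bigl(0,\ \lambda(b_1x+v_1\alpha x^2)-v_1z+w,\ 0,\ -\lambda v_1z\bigr).$$ Then $JH$ is nilpotent and the rows of $JH$ are linearly independent over $\mathbb{R}$. Moreover, $\lambda I+H$ is an example to the Weak Markus--Yamabe Conjecture if $\lambda<0$, and an example to the Jacobian Conjecture if $\lambda=1$.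
   Context: $I$ is the identity map of $\mathbb{R}^4$ and $JH$ is the Jacobian matrix of $H$, with polynomial entries; its rows are linearly independent over $\mathbb{R}$ if no nontrivial linear combination of them with constant real coefficients vanishes identically. Jacobian Conjecture on $\mathbb{R}^n$: every polynomial map $F:\mathbb{R}^n\to\mathbb{R}^n$ with $\det JF\equiv 1$ is bijective with polynomial inverse. Weak Markus--Yamabe Conjecture: every $C^1$ Hurwitz map $F:\mathbb{R}^n\to\mathbb{R}^n$ (i.e. one such that for every $x$ all eigenvalues of $JF(x)$ have negative real part) is injective. A map is ''an example to'' one of these conjectures if it satisfies both the hypothesis and the conclusion of the conjecture: respectively, $\det JF\equiv 1$ and $F$ is bijective with polynomial inverse; or $F$ is $C^1$ Hurwitz and injective.
   Formalization: The linear independence of the rows of JH is claimed only for non-constant f, since for constant f the first component of H is constant and the first row of JH vanishes; all other claims hold for every f. *)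

(* Defs.v *)
From mathcomp Require Import all_boot all_order all_algebra.
From mathcomp Require Import classical_sets reals topology normedtype derive.
From mathcomp Require Import complex.
From mathcomp Require Import -(notations) mpoly.

Set Implicit Arguments.
Unset Strict Implicit.
Unset Printing Implicit Defensive.

Import GRing.Theory Num.Theory.
Import numFieldNormedType.Exports.
Local Open Scope ring_scope.

(* The library's [jacobian F x] acts on row vectors from the right, so its
   (j, i) entry is dF_i/dx_j; transposing gives the usual Jacobian matrix,
   whose i-th row is the gradient of F_i. *)
Definition Jac (R : realType) (n : nat) (F : 'rV[R]_n -> 'rV[R]_n)
    (x : 'rV[R]_n) : 'M[R]_n :=
  (jacobian F x)^T.

Definition polynomial_map (R : realType) (n : nat)
    (F : 'rV[R]_n -> 'rV[R]_n) : Prop :=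
  exists P : 'I_n -> mpoly n R, forall x i, F x 0 i = meval (x 0) (P i).

(* A matrix of functions is nilpotent when one of its powers, with an exponent
   independent of the point, is the zero matrix of functions. *)
Definition nilpotent_mxfun (R : realType) (n : nat)
    (A : 'rV[R]_n -> 'M[R]_n) : Prop :=
  exists k : nat, forall x, A x ^+ k = 0.

(* Independence over the constants R of the rows of a matrix of functions;
   this does not mean that the rows of each A x are independent. *)
Definition rows_independent (R : realType) (n : nat)
    (A : 'rV[R]_n -> 'M[R]_n) : Prop :=
  forall c : 'rV[R]_n, (forall x, c *m A x = 0) -> c = 0.

Definition C1_map (R : realType) (n : nat) (F : 'rV[R]_n -> 'rV[R]_n) : Prop :=
  (forall x, differentiable F x) /\ continuous (Jac F).

Definition hurwitz (R : realType) (n : nat) (F : 'rV[R]_n -> 'rV[R]_n) : Prop :=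
  forall (x : 'rV[R]_n) (mu : R[i]),
    eigenvalue (map_mx (real_complex R) (Jac F x)) mu -> complex.Re mu < 0.

Definition weak_markus_yamabe_example (R : realType) (n : nat)
    (F : 'rV[R]_n -> 'rV[R]_n) : Prop :=
  [/\ C1_map F, hurwitz F & injective F].

Definition jacobian_conjecture_example (R : realType) (n : nat)
    (F : 'rV[R]_n -> 'rV[R]_n) : Prop :=
  [/\ polynomial_map F,
      forall x, \det (Jac F x) = 1 &
      exists G : 'rV[R]_n -> 'rV[R]_n,
        [/\ polynomial_map G, cancel F G & cancel G F]].

Definition row4 (R : realType) (a b c d : R) : 'rV[R]_4 :=
  \row_(j < 4) [:: a; b; c; d]`_j.

Definition Hmap (R : realType) (lambda b1 v1 alpha : R) (f : {poly R})
    (p : 'rV[R]_4) : 'rV[R]_4 :=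
  let x := p 0 0 in let y := p 0 1 in let z := p 0 2 in let w := p 0 3 in
  let t := lambda * (y + b1 * x + v1 * alpha * x ^+ 2) in
  f.[t] *: row4 (-1) (b1 + 2 * v1 * alpha * x) (- alpha * f.[t])
                (lambda * (b1 + 2 * v1 * alpha * x))
  + row4 0 (lambda * (b1 * x + v1 * alpha * x ^+ 2) - v1 * z + w) 0
         (- lambda * v1 * z).

(* Main.v *)
(* Put t = lambda (y + b1 x + v1 alpha x^2), b = dt/dx / lambda, s = lambda f'(t),
   r = (b, 1, 0, 0), N = JH.  Acting on row vectors, N sends r to
   m = (2 v1 alpha f + lambda b, 0, -v1, 1), then m to
   n = (2 lambda v1 alpha f, 0, -lambda v1, 0), and n to 0; as the rows of N lie
   in the span of r, m, n, N^4 = 0.  Hence lambda is the only eigenvalue of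
   lambda I + JH.  For the inverse of F = lambda I + H, observe that
   F_2 - F_4 / lambda = t, after which x, z, y, w are read off in turn from F.
   The columns 4, 3 and 2 of a relation c JH = 0 give c_2 = 0, c_4 = 0 and
   f' (c_1 + 2 alpha c_3 f) = 0. *)
From HB Require Import structures.
Require Import Defs.
From mathcomp Require Import all_boot all_order all_algebra.
From mathcomp Require Import classical_sets boolp functions reals topology normedtype derive.
From mathcomp Require Import complex polyorder ring.
From mathcomp Require Import -(notations) mpoly.

Set Implicit Arguments.
Unset Strict Implicit.

Import Order.TTheory GRing.Theory Num.Theory.
Import numFieldNormedType.Exports.
Local Open Scope ring_scope.

(** * Differentials and Jacobian matrices of polynomial maps *)

Section PolynomialCalculus.
Variables (R : realType) (n : nat).
Implicit Types (P Q : mpoly n R) (x : 'rV[R]_n).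

Definition mpoly_diff P x (v : 'rV[R]_n) : R :=
  \sum_j v 0 j * meval (x 0) (mderiv j P).

Definition has_mpoly_diff P :=
  forall x, is_diff x (fun y => meval (y 0) P) (mpoly_diff P x).

Lemma has_mpoly_diffC c : has_mpoly_diff (mpolyC n c).
Proof.
move=> x; have -> : (fun y : 'rV[R]_n => meval (y 0) (mpolyC n c)) = cst c.
  by apply/funext => y; rewrite mevalC.
apply: is_diff_eq; apply/funext => v; rewrite /mpoly_diff big1// => j _.
by rewrite mderivC meval0 mulr0.
Qed.

Lemma has_mpoly_diffD P Q :
  has_mpoly_diff P -> has_mpoly_diff Q -> has_mpoly_diff (P + Q).
Proof.
move=> dP dQ x; have -> : (fun y : 'rV[R]_n => meval (y 0) (P + Q)) =
   (fun y => meval (y 0) P) + (fun y => meval (y 0) Q).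
  by apply/funext => y; rewrite mevalD.
have := dP x; have := dQ x => ? ?.
apply: is_diff_eq; apply/funext => v; rewrite /mpoly_diff fctE -big_split/=.
by apply: eq_bigr => j _; rewrite mderivD mevalD mulrDr.
Qed.

Lemma has_mpoly_diffM P Q :
  has_mpoly_diff P -> has_mpoly_diff Q -> has_mpoly_diff (P * Q).
Proof.
move=> dP dQ x; have -> : (fun y : 'rV[R]_n => meval (y 0) (P * Q)) =
   (fun y => meval (y 0) P) * (fun y => meval (y 0) Q).
  by apply/funext => y; rewrite mevalM.
have := dP x; have := dQ x => ? ?.
apply: is_diff_eq; apply/funext => v; rewrite /mpoly_diff !fctE/=.
rewrite /GRing.scale/= !mulr_sumr -big_split/=.
by apply: eq_bigr => j _; rewrite mderivM mevalD !mevalM; ring.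
Qed.

Lemma mderivXU (i j : 'I_n) :
  mderiv j (mpolyX R (mnm1 i)) = (i == j)%:R :> mpoly n R.
Proof.
rewrite mderivX mnm1E; case: eqVneq => [->|_]; last by rewrite scale0r.
rewrite scale1r; have -> : mnm_sub (mnm1 j) (mnm1 j) = mnm0 :> multinom n.
  by apply/mnmP => k; rewrite mnmBE subnn mnm0E.
by rewrite mpolyX0.
Qed.

(** A continuous linear form is its own differential; the coordinate is packed as a linear map so
    that [diff_lin] applies. *)
Lemma is_diff_coord (x : 'rV[R]_n) i :
  is_diff x (fun y : 'rV[R]_n => y 0 i) (fun v : 'rV[R]_n => v 0 i).
Proof.
have lin : linear (fun v : 'rV[R]_n => v 0 i).
  by move=> a u v; rewrite !mxE.
pose linM := GRing.isLinear.Build _ _ _ _ _ lin.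
pose L : {linear 'rV[R]_n -> R} := HB.pack (fun v : 'rV[R]_n => v 0 i) linM.
have Lc : continuous L by exact: coord_continuous.
have -> : (fun v : 'rV[R]_n => v 0 i) = L by [].
by apply: DiffDef; [exact: linear_differentiable|exact: diff_lin].
Qed.

Lemma has_mpoly_diffXU i : has_mpoly_diff (mpolyX R (mnm1 i)).
Proof.
move=> x; have -> : (fun y : 'rV[R]_n => meval (y 0) (mpolyX R (mnm1 i))) =
   (fun y => y 0 i).
  by apply/funext => y; rewrite mevalXU.
have dx := is_diff_coord x i.
apply: is_diff_eq; apply/funext => v; rewrite /mpoly_diff (bigD1 i)//= big1.
  by rewrite mderivXU eqxx meval1 mulr1 addr0.
by move=> j /negbTE ji; rewrite mderivXU eq_sym ji meval0 mulr0.
Qed.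

(** Induction on the terms of [P]: each monomial unfolds into a product of powers of variables, so
    the rules for constants, variables, sums and products suffice. *)
Lemma meval_is_diff P : has_mpoly_diff P.
Proof.
elim/mpolyind: P => [|c m P _ _ IH].
  by rewrite -[0](mpolyC0 n R); exact: has_mpoly_diffC.
apply: has_mpoly_diffD => //; rewrite -mul_mpolyC.
apply: has_mpoly_diffM; first exact: has_mpoly_diffC.
have mpoly1 : has_mpoly_diff 1 by exact: has_mpoly_diffC.
rewrite mpolyXE_id; elim/big_rec: _ => // i Q _; apply: has_mpoly_diffM.
elim: (m i) => [|k IHk]; first by rewrite expr0.
by rewrite exprS; apply: has_mpoly_diffM => //; exact: has_mpoly_diffXU.
Qed.

(** [M] is the sum of its entries times the constant matrices [delta_mx i j]. *)
Lemma differentiable_mx (m p : nat) (M : 'rV[R]_n -> 'M[R]_(m, p)) x :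
  (forall i j, differentiable (fun y => M y i j) x) -> differentiable M x.
Proof.
move=> dM; have -> : M =
    \sum_(i < m) \sum_(j < p) (fun y => M y i j *: delta_mx i j).
  apply/funext => y; rewrite {1}[M y]matrix_sum_delta fct_sumE.
  by apply: eq_bigr => i _; rewrite fct_sumE.
do 2!(apply: differentiable_sum => ?).
exact: differentiableZl.
Qed.

Lemma differentiable_meval P x :
  differentiable (fun y : 'rV[R]_n => meval (y 0) P) x.
Proof. by have [] := meval_is_diff P x. Qed.

Section Map.
Variables (F : 'rV[R]_n -> 'rV[R]_n) (P : 'I_n -> mpoly n R).
Hypothesis FP : forall x i, F x 0 i = meval (x 0) (P i).

Lemma differentiable_polynomial x : differentiable F x.
Proof.
apply: differentiable_mx => i j; rewrite (ord1 i).
rewrite (_ : (fun y => _) = (fun y : 'rV[R]_n => meval (y 0) (P j))).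
  exact: differentiable_meval.
exact/funext.
Qed.

(** This replaces analysis by formal derivatives. Entry (i, j) is the derivative of the i-th
    component along the j-th basis vector, where the sum [mpoly_diff] collapses to one term. *)
Lemma Jac_polynomial x :
  Jac F x = \matrix_(i, j) meval (x 0) (mderiv j (P i)).
Proof.
apply/matrixP => i j; have dF := differentiable_polynomial x.
rewrite !mxE -deriveE// derive_mx ?mxE; last exact: diff_derivable.
rewrite (_ : (fun y => _) = (fun y : 'rV[R]_n => meval (y 0) (P i))); last exact/funext.
rewrite deriveE; last exact: differentiable_meval.
have [_ ->] := meval_is_diff (P i) x.
rewrite /mpoly_diff (bigD1 j)//= big1 => [|k /negbTE kj].
  by rewrite mxE !eqxx mul1r addr0.
by rewrite mxE kj andbF mul0r.
Qed.

(** The entries of the Jacobian matrix are again polynomial, hence differentiable and so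
    continuous. *)
Lemma C1_polynomial : C1_map F.
Proof.
split; first exact: differentiable_polynomial.
move=> x; apply: differentiable_continuous; apply: differentiable_mx => i j.
rewrite (_ : (fun y => _) = (fun y : 'rV[R]_n => meval (y 0) (mderiv j (P i)))).
  exact: differentiable_meval.
by apply/funext => y; rewrite Jac_polynomial mxE.
Qed.

End Map.
End PolynomialCalculus.

(** * Composition of a univariate polynomial with a multivariate one *)

Section HornerMpoly.
Variables (R : realType) (n : nat).
Implicit Types (f : {poly R}) (T : mpoly n R).

Definition mhorner f T : mpoly n R := (map_poly (@mpolyC n R) f).[T].

Lemma meval_mhorner v f T : meval v (mhorner f T) = f.[meval v T].
Proof.
rewrite /mhorner; elim/poly_ind: f => [|f c IH].
  by rewrite rmorph0 !horner0 meval0.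
by rewrite rmorphD rmorphM/= map_polyX map_polyC/= !hornerMXaddC mevalD mevalM
   IH mevalC.
Qed.

(** The chain rule, by induction along the Horner scheme of [f]. *)
Lemma mderiv_mhorner j f T :
  mderiv j (mhorner f T) = mhorner f^`() T * mderiv j T.
Proof.
rewrite /mhorner; elim/poly_ind: f => [|f c IH].
  by rewrite deriv0 rmorph0 !horner0 mderiv0 mul0r.
rewrite derivMXaddC !(rmorphD, rmorphM)/= map_polyX map_polyC/= !hornerMXaddC.
by rewrite hornerD hornerMX mderivD mderivM mderivC IH; ring.
Qed.
End HornerMpoly.

(** * Eigenvalues of a scalar matrix plus a nilpotent one *)

Lemma mulmx_exp_eigen (K : fieldType) n (A : 'M[K]_n) (v : 'rV[K]_n) a k :
  v *m A = a *: v -> v *m (A ^+ k) = a ^+ k *: v.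
Proof.
move=> vA; elim: k => [|k IH]; first by rewrite !expr0 mulmx1 scale1r.
by rewrite exprS mulmxA vA -scalemxAl IH scalerA -exprS.
Qed.

(** An eigenvector [v] for [mu] satisfies [v *m A = (mu - a) *: v], so [A ^+ k = 0] forces
    [(mu - a) ^+ k = 0]. *)
Lemma eigenvalue_shift_nilpotent (K : fieldType) n (A : 'M[K]_n) k a mu :
  A ^+ k = 0 -> eigenvalue (a%:M + A) mu -> mu = a.
Proof.
move=> Ak /eigenvalueP[v]; rewrite mulmxDr mul_mx_scalar => vA v0.
have /(@mulmx_exp_eigen _ _ _ _ _ k) : v *m A = (mu - a) *: v.
  by rewrite scalerBl -vA addrAC subrr add0r.
rewrite Ak mulmx0 => /esym/eqP; rewrite scaler_eq0 (negbTE v0) orbF.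
by rewrite expf_eq0 subr_eq0 => /andP[_ /eqP].
Qed.

Lemma map_mx_exp (R S : pzRingType) (h : {rmorphism R -> S}) n (A : 'M[R]_n) k :
  map_mx h (A ^+ k) = map_mx h A ^+ k.
Proof.
elim: k => [|k IH]; first by rewrite !expr0 map_mx1.
by rewrite !exprS map_mxM IH.
Qed.

(** Nilpotency survives the embedding of [R] into [R[i]], so [a] is the only possible complex
    eigenvalue. *)
Lemma hurwitz_shift (R : realType) n (F H : 'rV[R]_n -> 'rV[R]_n) (a : R) :
  (forall x, Jac F x = a%:M + Jac H x) -> nilpotent_mxfun (Jac H) -> a < 0 ->
  hurwitz F.
Proof.
move=> JF [k Hk] a0 x mu; rewrite JF map_mxD map_scalar_mx => ev.
suff -> : mu = real_complex R a by [].
by apply: (@eigenvalue_shift_nilpotent _ _ _ k) ev; rewrite -map_mx_exp Hk map_mx0.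
Qed.

(** The integers from 0 to [size p - 1] are distinct in [R] and give more roots than the degree
    allows. *)
Lemma horner_eq0 (R : numDomainType) (p : {poly R}) :
  (forall x, p.[x] = 0) -> p = 0.
Proof.
move=> p0; apply: (@roots_geq_poly_eq0 _ p [seq i%:R | i <- iota 0 (size p)]).
- by apply/allP => x _; apply/rootP.
- by rewrite map_inj_uniq ?iota_uniq// => i j /eqP; rewrite eqr_nat => /eqP.
- by rewrite size_map size_iota.
Qed.

Lemma forall_ord4 (P : 'I_4 -> Prop) : P 0 -> P 1 -> P 2 -> P 3 -> forall i, P i.
Proof.
move=> P0 P1 P2 P3; case=> -[|[|[|[|//]]]] i4.
- by have -> : Ordinal i4 = 0 by exact/val_inj.
- by have -> : Ordinal i4 = 1 by exact/val_inj.
- by have -> : Ordinal i4 = 2 by exact/val_inj.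
- by have -> : Ordinal i4 = 3 by exact/val_inj.
Qed.

Lemma row4_ext (T : Type) (u v : 'rV[T]_4) :
  u 0 0 = v 0 0 -> u 0 1 = v 0 1 -> u 0 2 = v 0 2 -> u 0 3 = v 0 3 -> u = v.
Proof. by move=> *; apply/rowP; apply: forall_ord4. Qed.

Lemma sum_ord4 (V : nmodType) (F : 'I_4 -> V) :
  \sum_i F i = F 0 + F 1 + F 2 + F 3.
Proof.
rewrite !big_ord_recl big_ord0 addr0 !addrA.
by congr (F _ + F _ + F _ + F _); exact/val_inj.
Qed.

(** * The map [H], its Jacobian matrix and nilpotency *)

Section Example.
Variables (R : realType) (lambda b1 v1 alpha : R) (f : {poly R}).
Notation H := (Hmap lambda b1 v1 alpha f).

Let X (i : 'I_4) : mpoly 4 R := mpolyX R (mnm1 i).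
Let C : R -> mpoly 4 R := @mpolyC 4 R.

(** [Q], [B] and [Phi] are the formal versions of t / lambda - y, of b and of f(t). Squares are
    written as products so that the product rule alone differentiates them. *)
Let Q := C b1 * X 0 + C (v1 * alpha) * (X 0 * X 0).
Let B := C b1 + C (2 * v1 * alpha) * X 0.
Let Phi := mhorner f (C lambda * (X 1 + Q)).

Definition Hpoly (i : 'I_4) : mpoly 4 R :=
  [:: - Phi; Phi * B + C lambda * Q - C v1 * X 2 + X 3; - (C alpha * (Phi * Phi));
      C lambda * (B * Phi) - C (lambda * v1) * X 2]`_i.

Definition Tmap (p : 'rV[R]_4) : R :=
  lambda * (p 0 1 + b1 * p 0 0 + v1 * alpha * p 0 0 ^+ 2).

Lemma HpolyE p i : H p 0 i = meval (p 0) (Hpoly i).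
Proof.
rewrite /Hmap /Hpoly !mxE -/(Tmap p).
have phiE : meval (p 0) Phi = f.[Tmap p].
  rewrite meval_mhorner /Tmap /C /X !(mevalD, mevalM, mevalC, mevalXU).
  by congr _.[_]; ring.
case: i => -[|[|[|[|//]]]] i4 /=;
  rewrite !(mevalN, mevalD, mevalM, mevalC, mevalXU) phiE; ring.
Qed.

(** [phi] stands for f(t), [s] and [b] are as in the header. Keeping them as free parameters turns
    nilpotency and the determinant into identities for [ring]. *)
Definition Hjac (s phi b : R) : 'M[R]_4 := \matrix_(i < 4)
  [:: row4 (- s * b) (- s) 0 0;
      row4 (s * b ^+ 2 + 2 * v1 * alpha * phi + lambda * b) (s * b) (- v1) 1;
      row4 (- 2 * alpha * phi * s * b) (- 2 * alpha * phi * s) 0 0;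
      row4 (lambda * (s * b ^+ 2 + 2 * v1 * alpha * phi)) (lambda * s * b)
           (- lambda * v1) 0]`_i.

Lemma Jac_HmapE p : Jac H p =
  Hjac (lambda * f^`().[Tmap p]) f.[Tmap p] (b1 + 2 * v1 * alpha * p 0 0).
Proof.
rewrite (Jac_polynomial HpolyE); apply/matrixP => i j; rewrite !mxE.
(* Stated for all [g], since both [f] and its derivative occur. *)
have phiE g : meval (p 0) (mhorner g (C lambda * (X 1 + Q))) = g.[Tmap p].
  rewrite meval_mhorner /Tmap /C /X !(mevalD, mevalM, mevalC, mevalXU).
  by congr _.[_]; ring.
case: i => -[|[|[|[|//]]]] ?; case: j => -[|[|[|[|//]]]] ?;
  rewrite ?mxE /Hpoly /=;
  rewrite !(mderivN, mderivD, mderivM, mderivC, mderivXU, mderiv_mhorner);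
  rewrite !(mevalN, mevalD, mevalM, mevalC, mevalXU, mevalMn, meval0, meval1, phiE) /=;
  ring.
Qed.

Lemma Hjac_exp4 s phi b : Hjac s phi b ^+ 4 = 0.
Proof.
(* In the notation of the header: N = u r + e_2 m + e_4 n for a column u, so
   the square is u m + e_2 n. *)
have A2 : Hjac s phi b *m Hjac s phi b = \matrix_(i, j)
   ([:: - s; s * b; - 2 * alpha * phi * s; lambda * s * b]`_i *
    [:: 2 * v1 * alpha * phi + lambda * b; 0; - v1; 1]`_j +
    (i == 1)%:R * [:: 2 * lambda * v1 * alpha * phi; 0; - lambda * v1; 0]`_j).
  apply/matrixP => i j; rewrite !mxE !big_ord_recl big_ord0 !mxE/=.
  by case: i => -[|[|[|[|//]]]] ?; case: j => -[|[|[|[|//]]]] ?;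
    rewrite /= !mxE/=; ring.
(* The rows m and n both annihilate the columns u and e_2, so the square of u m + e_2 n vanishes. *)
rewrite (exprD _ 2 2) expr2 -![LHS]/(_ *m _) -![Hjac _ _ _ * _]/(_ *m _) A2.
apply/matrixP => i j; rewrite !mxE !big_ord_recl big_ord0 !mxE/=.
by case: i => -[|[|[|[|//]]]] ?; case: j => -[|[|[|[|//]]]] ? /=; ring.
Qed.

(** Three expansions along the first row lead down to 1 by 1 minors; the value reflects that [a] is
    the only eigenvalue. *)
Lemma det_Hjac a s phi b : \det (a%:M + Hjac s phi b) = a ^+ 4.
Proof.
do 3 rewrite ?(expand_det_row _ 0) ?big_ord_recl ?big_ord0 /cofactor /=.
by rewrite !det_mx11 !mxE /= !mulr1n !mulr0n; ring.
Qed.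

Lemma nilpotent_Jac_Hmap : nilpotent_mxfun (Jac H).
Proof. by exists 4 => p; rewrite Jac_HmapE Hjac_exp4. Qed.

(** * The map [lambda I + H] and its polynomial inverse *)

Notation F := (fun p => lambda *: p + H p).

Definition Fpoly i := C lambda * X i + Hpoly i.

Lemma FpolyE p i : F p 0 i = meval (p 0) (Fpoly i).
Proof. by rewrite 2!mxE HpolyE mevalD mevalM mevalC mevalXU. Qed.

Lemma Jac_shift p : Jac F p = lambda%:M + Jac H p.
Proof.
rewrite (Jac_polynomial FpolyE) (Jac_polynomial HpolyE).
apply/matrixP => i j; rewrite !mxE mderivD mderivM mderivC mderivXU mul0r add0r.
by rewrite mevalD mevalM mevalC mevalMn meval1 mulr_natr.
Qed.

Hypothesis lambda0 : lambda != 0.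

Definition Ginv (q : 'rV[R]_4) : 'rV[R]_4 :=
  let t := q 0 1 - lambda^-1 * q 0 3 in
  let x := lambda^-1 * (q 0 0 + f.[t]) in
  let z := lambda^-1 * (q 0 2 + alpha * f.[t] ^+ 2) in
  row4 x (lambda^-1 * t - b1 * x - v1 * alpha * x ^+ 2) z
       (lambda^-1 * q 0 3 - (b1 + 2 * v1 * alpha * x) * f.[t] + v1 * z).

Definition Gpoly (i : 'I_4) : mpoly 4 R :=
  let T := X 1 - C lambda^-1 * X 3 in let phi := mhorner f T in
  let x := C lambda^-1 * (X 0 + phi) in
  let z := C lambda^-1 * (X 2 + C alpha * (phi * phi)) in
  [:: x; C lambda^-1 * T - C b1 * x - C (v1 * alpha) * (x * x); z;
      C lambda^-1 * X 3 - (C b1 + C (2 * v1 * alpha) * x) * phi + C v1 * z]`_i.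

Lemma GpolyE q i : Ginv q 0 i = meval (q 0) (Gpoly i).
Proof.
rewrite /Ginv /Gpoly mxE.
case: i => -[|[|[|[|//]]]] ? /=;
  rewrite !(mevalN, mevalD, mevalM, mevalC, mevalXU, meval_mhorner); ring.
Qed.

Lemma shift_HmapE p : F p =
  row4 (lambda * p 0 0 - f.[Tmap p])
    (lambda * p 0 1 + f.[Tmap p] * (b1 + 2 * v1 * alpha * p 0 0) +
       lambda * (b1 * p 0 0 + v1 * alpha * p 0 0 ^+ 2) - v1 * p 0 2 + p 0 3)
    (lambda * p 0 2 - alpha * f.[Tmap p] ^+ 2)
    (lambda * p 0 3 + lambda * (b1 + 2 * v1 * alpha * p 0 0) * f.[Tmap p]
       - lambda * v1 * p 0 2).
Proof. by apply: row4_ext; rewrite !mxE -/(Tmap p) /=; ring. Qed.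

Lemma shift_HmapK : cancel F Ginv.
Proof.
move=> p; rewrite shift_HmapE /Ginv !mxE /=; set t := Tmap p.
(* In F_2 - F_4 / lambda the terms in f(t), z and w cancel, leaving lambda (y + b1 x + v1 alpha
   x^2). *)
have -> : lambda * p 0 1 + f.[t] * (b1 + 2 * v1 * alpha * p 0 0) +
    lambda * (b1 * p 0 0 + v1 * alpha * p 0 0 ^+ 2) - v1 * p 0 2 + p 0 3 -
    lambda^-1 * (lambda * p 0 3 +
      lambda * (b1 + 2 * v1 * alpha * p 0 0) * f.[t] - lambda * v1 * p 0 2) = t.
  by rewrite /t /Tmap; field.
by apply: row4_ext; rewrite !mxE /= ?/t ?/Tmap; field.
Qed.

Lemma GinvK : cancel Ginv F.
Proof.
move=> q; rewrite shift_HmapE /=.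
(* The second coordinate of [Ginv q] is chosen to make this hold. *)
have -> : Tmap (Ginv q) = q 0 1 - lambda^-1 * q 0 3.
  by rewrite /Tmap /Ginv !mxE /=; field.
by rewrite /Ginv !mxE /=; apply: row4_ext; rewrite !mxE /=; field.
Qed.

(** * Constant linear relations between the rows of the Jacobian matrix *)

Hypothesis v1alpha0 : v1 * alpha != 0.

(** The condition on [size f] says that [f] is nonconstant: for constant [f] the derivative
    vanishes, and with it the first row of the matrix. *)
Lemma rows_independent_Jac_Hmap : (1 < size f)%N -> rows_independent (Jac H).
Proof.
move=> f1 c cJ.
have entry p j : \sum_i c 0 i * Jac H p i j = 0.
  by have /rowP/(_ j) := cJ p; rewrite !mxE.
have c2 : c 0 1 = 0.
  have := entry 0 3; rewrite Jac_HmapE sum_ord4 !mxE /=.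
  by rewrite !mulr0 mulr1 !addr0 add0r.
have v10 : v1 != 0 by apply: contraNneq v1alpha0 => ->; rewrite mul0r.
have c4 : c 0 3 = 0.
  have := entry 0 2; rewrite Jac_HmapE sum_ord4 !mxE /= c2.
  rewrite mul0r !mulr0 !add0r => /eqP.
  by rewrite !mulf_eq0 oppr_eq0 (negbTE lambda0) (negbTE v10) !orbF => /eqP.
have c13 t : f^`().[t] * (c 0 0 + 2 * alpha * f.[t] * c 0 2) = 0.
  (* At this point [Tmap] takes the prescribed value [t]. *)
  have := entry (row4 0 (lambda^-1 * t) 0 0) 1.
  rewrite Jac_HmapE sum_ord4 !mxE /= c2 c4.
  have -> : Tmap (row4 0 (lambda^-1 * t) 0 0) = t.
    by rewrite /Tmap !mxE /=; field.
  by move=> e; apply: (mulIf lambda0); rewrite mul0r -[RHS]oppr0 -[in RHS]e; ring.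
have f'0 : f^`() != 0.
  by rewrite -size_poly_eq0 size_deriv; case: (size f) f1 => [|[]].
(* The derivative may vanish at some [t], so it is cancelled in the integral domain [{poly R}] and
   not pointwise. *)
have : f^`() * ((c 0 0)%:P + (2 * alpha * c 0 2) *: f) = 0.
  by apply: horner_eq0 => t; rewrite !hornerE -(c13 t); ring.
move/eqP; rewrite mulf_eq0 (negbTE f'0)/= => /eqP c13f.
have c3 : c 0 2 = 0.
  (* Otherwise a nonzero multiple of [f] would equal the constant [- c 0 0]; the factor [alpha] is
     nonzero because [v1 * alpha] is. *)
  apply: contraTeq f1 => c30; rewrite -leqNgt.
  rewrite -(@size_scale _ (2 * alpha * c 0 2)) ?mulf_neq0// ?pnatr_eq0//.
    by rewrite -[_ *: f](addKr (c 0 0)%:P) c13f addr0 size_polyN size_polyC_leq1.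
  by apply: contraNneq v1alpha0 => ->; rewrite mulr0.
have c1 : c 0 0 = 0.
  by move: c13f; rewrite c3 mulr0 scale0r addr0 => /eqP; rewrite polyC_eq0 => /eqP.
by apply: row4_ext; rewrite mxE.
Qed.
End Example.

Theorem proposition4 (R : realType) (lambda b1 v1 alpha : R) (f : {poly R})
    (hlambda : lambda != 0) (hv1alpha : v1 * alpha != 0) :
  let H := Hmap lambda b1 v1 alpha f in
  [/\ nilpotent_mxfun (Jac H),
      (1 < size f)%N -> rows_independent (Jac H),
      lambda < 0 -> weak_markus_yamabe_example (fun p => lambda *: p + H p) &
      lambda = 1 -> jacobian_conjecture_example (fun p => lambda *: p + H p)].
Proof.
move=> H; split.
- exact: nilpotent_Jac_Hmap.
- exact: rows_independent_Jac_Hmap.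
- move=> lambda_lt0; split.
  + exact: C1_polynomial (FpolyE _ _ _ _ _).
  + exact: hurwitz_shift (Jac_shift _ _ _ _ _) (nilpotent_Jac_Hmap _ _ _ _ _) _.
  + exact: can_inj (shift_HmapK _ _ _ _ _).
- move=> lambda1; split.
  + by exists (Fpoly lambda b1 v1 alpha f); exact: FpolyE.
  + by move=> p; rewrite Jac_shift Jac_HmapE det_Hjac lambda1 expr1n.
  + exists (Ginv lambda b1 v1 alpha f); split.
    * by exists (Gpoly lambda b1 v1 alpha f); exact: GpolyE.
    * exact: shift_HmapK.
    * exact: GinvK.
Qed.
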